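(* Let $X$ be a $k$-regular bipartite distance-regular graph of diameter $3$ for $k\geq 400$. Then $X$ is a cocktail-party graph, or $\mathrm{motion}(X)\geq \frac{1}{100}n$.
   Context: $n$ is the number of vertices of $X$. For a graph $X$, $\mathrm{motion}(X)$ denotes the minimal degree of its automorphism group $\mathrm{Aut}(X)$, i.e., the minimum number of vertices not fixed by a non-identity automorphism. A cocktail-party graph is obtained from a regular complete bipartite graph by deleting one perfect matching. *)

(* Defs.v *)
From HB Require Import structures.
From mathcomp Require Import all_boot all_order all_algebra all_fingroup.

Set Implicit Arguments.
Unset Strict Implicit.
Unset Printing Implicit Defensive.

Record sgraph := SGraph {
  vertex :> finType;
  edge : rel vertex;
  edge_sym : symmetric edge;
  edge_irr : irreflexive edge }.

Section Graph.
Variable X : sgraph.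
Implicit Types (x y : X) (A : {set X}) (M : {set {set X}}).

Definition neighbours x : {set X} := [set y | edge x y].

Definition regular (k : nat) : Prop := forall x, #|neighbours x| = k.

Definition connected : Prop := forall x y, connect (@edge X) x y.

Definition walk (m : nat) x y : bool :=
  [exists p : m.-tuple X, path (@edge X) x p && (last x p == y)].

(* Least length of a walk from x to y; the junk value #|X| if there is none. *)
Definition dist x y : nat := find (fun m => walk m x y) (iota 0 #|X|).

Lemma dist_walk x y : connect (@edge X) x y -> walk (dist x y) x y.
Proof.
move=> /connectP[p ep ->].
have [p' ep' up' _] := shortenP ep.
have sp' : size p' < #|X| by rewrite -/(size (x :: p')) -(card_uniqP up') max_card.
have hs : has (fun m => walk m x (last x p')) (iota 0 #|X|).
  apply/hasP; exists (size p'); first by rewrite mem_iota.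
  by apply/existsP; exists (in_tuple p'); rewrite /= ep' eqxx.
have := nth_find 0 hs; rewrite nth_iota ?add0n //.
by move: hs; rewrite has_find size_iota.
Qed.

Lemma dist_min m x y : walk m x y -> dist x y <= m.
Proof.
move=> w; case: (ltnP m (dist x y)) => // lt_m.
have lt_mX : m < #|X|.
  by apply: leq_trans lt_m _; rewrite -[leqRHS](size_iota 0) find_size.
by have := before_find 0 lt_m; rewrite nth_iota // add0n w.
Qed.

Definition diameter : nat := \max_(x : X) \max_(y : X) dist x y.

Definition distance_regular : Prop :=
  connected /\
  forall i, i <= diameter -> exists a b c : nat, forall x y, dist x y = i ->
    [/\ #|[set z in neighbours y | dist x z == i]| = a,
        #|[set z in neighbours y | dist x z == i.+1]| = b &
        #|[set z in neighbours y | (dist x z).+1 == i]| = c].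

Definition bipartite : Prop :=
  exists A, forall x y, edge x y -> (x \in A) != (y \in A).

(* A perfect matching of the complete bipartite graph with parts A and ~: A,
   as a partition of the vertex set into edges. *)
Definition perfect_matching_between A M : Prop :=
  partition M [set: X] /\
  forall B, B \in M -> exists x y, [/\ x \in A, y \notin A & B = [set x; y]].

Definition cocktail_party : Prop :=
  exists A M,
    [/\ #|A| = #|~: A|, perfect_matching_between A M &
        forall x y,
          edge x y = ((x \in A) != (y \in A)) && ([set x; y] \notin M)].

Definition automorphisms : {set {perm X}} :=
  [set s : {perm X} | [forall x, forall y, edge (s x) (s y) == edge x y]].

Lemma group_set_automorphisms : group_set automorphisms.
Proof.
apply/group_setP; split.
  by rewrite inE; apply/forallP=> x; apply/forallP=> y; rewrite !perm1.
move=> s t; rewrite !inE => /forallP hs /forallP ht.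
apply/forallP=> x; apply/forallP=> y; rewrite !permM.
by rewrite (eqP (forallP (ht _) _)) (forallP (hs _) _).
Qed.

Canonical automorphisms_group := Group group_set_automorphisms.

End Graph.

Definition perm_degree (T : finType) (s : {perm T}) : nat :=
  #|[set x | s x != x]|.

(* No degree exceeds #|T|, so the unit #|T| of the minimum only matters for the
   trivial group, whose minimal degree is thereby #|T|. *)
Definition minimal_degree (T : finType) (G : {set {perm T}}) : nat :=
  \big[minn/#|T|]_(s in G | s != 1%g) perm_degree s.

Definition motion (X : sgraph) : nat := minimal_degree (automorphisms X).

(* Main.v *)
(** A bipartite distance-regular graph of diameter 3 is the incidence graph of a
    symmetric design with parameters [(v, k, l)], [v > k].  Let an automorphism
    preserving the parts fix [f] points and [f' <= f < v] blocks.  A moved block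
    meets its image in [l] points, so it has at most [l] fixed points; hence it
    is far below the average [k f / v] if [f] is near [v] and [2 l <= k].  Since
    the variance of the number of fixed points on a block is small, only few
    blocks can be moved, contradicting [v - f <= v - f'].  If [2 k <= v] then
    [2 l <= k]; otherwise the argument applies to the complementary design,
    whose block size is 1 exactly for the cocktail-party graphs. *)
Require Import Defs.
From HB Require Import structures.
From mathcomp Require Import all_boot all_order all_algebra all_fingroup.
From mathcomp Require Import zify ring.

Set Implicit Arguments.
Unset Strict Implicit.
Unset Printing Implicit Defensive.

Import Order.TTheory GRing.Theory Num.Theory.
Local Open Scope ring_scope.

Lemma sum_card_exchange (T : finType) (r : rel T) (A B : {set T}) :
  (\sum_(x in A) #|[set y in B | r x y]| =
   \sum_(y in B) #|[set x in A | r x y]|)%N.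
Proof.
under eq_bigr => x _ do rewrite -sum1dep_card big_mkcondr.
under [RHS]eq_bigr => x _ do rewrite -sum1dep_card big_mkcondr.
by rewrite exchange_big.
Qed.

(** * Symmetric designs: counting and fixed points *)

Section SymmetricDesign.

Variables (T : finType).
Implicit Types (e : rel T) (P Q F : {set T}) (v k l : nat).

(* Points [P], blocks [Q]; the incidence [e p q] is only used for [p] in [P]
   and [q] in [Q]. *)
Definition symmetric_design e P Q v k l : Prop :=
  [/\ #|P| = v /\ #|Q| = v,
      {in P, forall p, #|[set q in Q | e p q]| = k},
      {in Q, forall q, #|[set p in P | e p q]| = k},
      {in P &, forall p p', p != p' -> #|[set q in Q | e p q && e p' q]| = l} &
      {in Q &, forall q q', q != q' -> #|[set p in P | e p q && e p q']| = l}].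

Lemma symmetric_design_dual e P Q v k l :
  symmetric_design e P Q v k l ->
  symmetric_design (fun x y => e y x) Q P v k l.
Proof. by case=> [[? ?] ? ? ? ?]; split. Qed.

Lemma card_filterC (S : {set T}) (a : pred T) :
  #|[set x in S | ~~ a x]| = (#|S| - #|[set x in S | a x]|)%N.
Proof.
have -> : [set x in S | ~~ a x] = S :\: [set x in S | a x].
  by apply/setP => x; rewrite !inE; case: (x \in S); case: (a x).
rewrite cardsD (setIidPr _) //.
by apply/subsetP => x; rewrite inE => /andP[].
Qed.

Lemma card_filterCC (S : {set T}) (a b : pred T) :
  #|[set x in S | ~~ a x && ~~ b x]| =
  (#|S| + #|[set x in S | a x && b x]| -
     (#|[set x in S | a x]| + #|[set x in S | b x]|))%N.
Proof.
have -> : [set x in S | a x && b x] = [set x in S | a x] :&: [set x in S | b x].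
  by apply/setP => x; rewrite !inE; case: (x \in S).
have -> : [set x in S | ~~ a x && ~~ b x] =
          [set x in S | ~~ (a x || b x)].
  by apply/setP => x; rewrite !inE negb_or.
have sub : [set x in S | a x || b x] \subset S.
  by apply/subsetP => x; rewrite inE => /andP[].
have := subset_leq_card sub; rewrite card_filterC.
have -> : [set x in S | a x || b x] = [set x in S | a x] :|: [set x in S | b x].
  by apply/setP => x; rewrite !inE andb_orr.
have := cardsUI [set x in S | a x] [set x in S | b x].
lia.
Qed.

(** Inclusion-exclusion: [k + k - l] blocks meet a pair of points, and the other blocks avoid
    both. *)
Lemma symmetric_design_compl e P Q v k l :
  symmetric_design e P Q v k l ->
  symmetric_design (fun x y => ~~ e x y) P Q v (v - k) (v + l - (k + k)).
Proof.
case=> [[cP cQ] rP rQ pP pQ]; split=> //.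
- by move=> p Pp; rewrite card_filterC cQ rP.
- by move=> q Qq; rewrite card_filterC cP rQ.
- by move=> p p' Pp Pp' ne; rewrite card_filterCC cQ !rP // pP.
- by move=> q q' Qq Qq' ne; rewrite card_filterCC cP !rQ // pQ.
Qed.

(** Double counting of the incidences between [F] and the blocks through [p]: the point [p] lies on
    [k] of them, each other point of [F] on [l]. The term [l] is added on the left to avoid a
    subtraction. *)
Lemma symmetric_design_pencil e P Q v k l F p :
  symmetric_design e P Q v k l -> F \subset P -> p \in F ->
  (\sum_(q in [set q in Q | e p q]) #|[set x in F | e x q]| + l =
   k + l * #|F|)%N.
Proof.
case=> [_ rP _ pP _] /subsetP sFP Fp; rewrite -sum_card_exchange (bigD1 p) //=.
have -> : [set q in [set q in Q | e p q] | e p q] = [set q in Q | e p q].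
  by apply/setP => q; rewrite !inE -andbA andbb.
rewrite rP ?sFP // (eq_bigr (fun=> l)) => [|x /andP[Fx nxp]].
  rewrite (eq_bigl (fun x => x \in F :\ p)) => [|x]; last by rewrite !inE andbC.
  by rewrite sum_nat_const (cardsD1 p F) Fp; lia.
rewrite -(pP p x) ?sFP // 1?eq_sym //.
by apply: eq_card => q; rewrite !inE andbA.
Qed.

(** The classical identity k(k - 1) = l(v - 1): take [F := P] in the pencil count. *)
Lemma symmetric_design_count e P Q v k l :
  symmetric_design e P Q v k l -> (0 < v)%N -> (k * k + l = k + l * v)%N.
Proof.
move=> D v0; have [[cP _] rP rQ _ _] := D.
have [p Pp] : exists p, p \in P by apply/set0Pn; rewrite -card_gt0 cP.
rewrite -[in RHS]cP -(symmetric_design_pencil D (subxx _) Pp).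
congr (_ + _)%N; rewrite (eq_bigr (fun=> k)) => [|q].
  by rewrite sum_nat_const rP.
by rewrite inE => /andP[Qq _]; rewrite rQ.
Qed.

(** The second moment is the pencil count summed over [p] in [F], because a block [q] contributes
    [a q] once for each of its [a q] points in [F]. *)
Lemma symmetric_design_moments e P Q v k l F :
  symmetric_design e P Q v k l -> F \subset P ->
  let a q := #|[set x in F | e x q]| in
  (\sum_(q in Q) a q = k * #|F| /\
   \sum_(q in Q) a q * a q + l * #|F| = (k + l * #|F|) * #|F|)%N.
Proof.
move=> D sFP a; have [_ rP _ _ _] := D; split.
  rewrite -sum_card_exchange (eq_bigr (fun=> k)) ?sum_nat_const 1?mulnC //.
  by move=> p Fp; rewrite rP // (subsetP sFP).
have -> : (\sum_(q in Q) a q * a q =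
           \sum_(p in F) \sum_(q in [set q in Q | e p q]) a q)%N.
  under eq_bigr => q _ do rewrite {1}/a -sum1dep_card big_distrl big_mkcondr /=.
  rewrite exchange_big; apply: eq_bigr => p _; rewrite -big_mkcondr /=.
  by apply: eq_big => q; rewrite ?inE // mul1n.
rewrite ![(_ * #|F|)%N]mulnC -!sum_nat_const -big_split /=.
by apply: eq_bigr => p Fp; rewrite (symmetric_design_pencil D) // sum_nat_const mulnC.
Qed.

(** The mean of [a q] is k f / v; scaling by [v] keeps everything integral. After expansion with
    both moments, the identity for k * k collapses the sum to a product. *)
Lemma symmetric_design_variance e P Q v k l F :
  symmetric_design e P Q v k l -> F \subset P -> (0 < v)%N ->
  \sum_(q in Q) (v%:Z * #|[set x in F | e x q]|%:Z - k%:Z * #|F|%:Z) ^+ 2 =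
  v%:Z * (k%:Z - l%:Z) * #|F|%:Z * (v%:Z - #|F|%:Z).
Proof.
move=> D sFP v0; have [m1 m2] := symmetric_design_moments D sFP.
have [[cP cQ] _ _ _ _] := D; have cnt := symmetric_design_count D v0.
set f := #|F| in m1 m2 *.
pose a q := #|[set x in F | e x q]|.
rewrite (eq_bigr (fun q => v%:Z ^+ 2 * (a q * a q)%N%:Z
    - 2 * v%:Z * k%:Z * f%:Z * (a q)%:Z + (k%:Z * f%:Z) ^+ 2)); last first.
  by move=> q _; rewrite -/(a q) PoszM; ring.
rewrite big_split sumrB /= -!mulr_sumr sumr_const cQ.
rewrite -!(big_morph Posz PoszD (erefl 0%:Z)) -mulr_natr natz.
move: m1 m2; rewrite -/a; set S1 := (\sum_(q in Q) _)%N; set S2 := (\sum_(q in Q) _)%N.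
move=> -> m2.
have {}m2 : S2%:Z = (k%:Z + l%:Z * f%:Z) * f%:Z - l%:Z * f%:Z by lia.
have {}cnt : k%:Z * k%:Z = k%:Z + l%:Z * v%:Z - l%:Z by lia.
rewrite m2 PoszM; ring: cnt.
Qed.

(* A moved block [q] and its image have [l] points in common, among which are
   all fixed points on [q]. *)
Lemma card_fixed_on_moved_block e P Q v k l (s : {perm T}) q :
  symmetric_design e P Q v k l ->
  (forall x y, e (s x) (s y) = e x y) -> {in Q, forall x, s x \in Q} ->
  q \in Q -> s q != q ->
  (#|[set x in [set p in P | s p == p] | e x q]| <= l)%N.
Proof.
case=> [_ _ _ _ pQ] se sQ Qq nq; rewrite -(pQ q (s q)) ?sQ 1?eq_sym //.
apply/subset_leq_card/subsetP => x; rewrite !inE => /andP[/andP[-> /eqP sx] exq].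
by rewrite exq -{1}sx se exq.
Qed.

Lemma symmetric_design_fixed_points e P Q v k l (s : {perm T}) :
  symmetric_design e P Q v k l -> (5 <= k)%N -> (2 * l <= k)%N ->
  (forall x y, e (s x) (s y) = e x y) -> {in Q, forall x, s x \in Q} ->
  let f := #|[set x in P | s x == x]| in
  let f' := #|[set x in Q | s x == x]| in
  (f' <= f)%N -> (f' < v)%N -> (100 * f <= 99 * v)%N.
Proof.
move=> D k5 lk se sQ; set F := [set x in P | _]; set F' := [set x in Q | _].
move=> f f' lef ltf; have v0 : (0 < v)%N by lia.
have sFP : F \subset P by apply/subsetP => x; rewrite inE => /andP[].
have [[cP cQ] _ _ _ _] := D.
have lefv : (f <= v)%N by rewrite -cP subset_leq_card.
rewrite leqNgt; apply/negP => big.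
have dev : 0 <= k%:Z * f%:Z - l%:Z * v%:Z by nia.
(* Only the [v - f'] moved blocks are kept in the variance sum. *)
have low : (v%:Z - f'%:Z) * (k%:Z * f%:Z - l%:Z * v%:Z) ^+ 2 <=
           v%:Z * (k%:Z - l%:Z) * f%:Z * (v%:Z - f%:Z).
  rewrite -(symmetric_design_variance D sFP v0) (bigID (fun q => s q == q)) /=.
  rewrite ler_wpDl ?sumr_ge0 // => [q _|]; first exact: sqr_ge0.
  have -> : v%:Z - f'%:Z = #|[set q in Q | s q != q]|%:Z.
    by rewrite card_filterC cQ -subzn // ltnW.
  rewrite -[X in X * _]natz mulr_natl -sumr_const big_mkcond [leRHS]big_mkcond /=.
  apply: ler_sum => q _; rewrite inE; case: ifP => // /andP[Qq nq].
  have := card_fixed_on_moved_block D se sQ Qq nq.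
  rewrite -/F -/f; set a := #|_| => al; rewrite -subr_ge0 subr_sqr.
  have va : v%:Z * a%:Z <= v%:Z * l%:Z by rewrite ler_wpM2l.
  (* Since v a <= l v <= k f, both factors of the difference of squares are nonpositive. *)
  by rewrite -mulrNN mulr_ge0 //; lia.
set u := _ - _ in dev low.
(* Here [f' <= f] enters: v - f <= v - f', and the positive factor v - f' cancels. *)
have u_le : u ^+ 2 <= v%:Z * (k%:Z - l%:Z) * f%:Z.
  have vf : 0 < v%:Z - f'%:Z by lia.
  rewrite -(ler_pM2l vf); apply: (le_trans low); rewrite mulrC.
  by rewrite ler_wpM2r ?mulr_ge0 //; lia.
(* The constant is 49/100 = 99/100 - 1/2, from f > 99 v / 100 and l <= k / 2. *)
have u_ge : 49 * (k%:Z * v%:Z) <= 100 * u.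
  have : k%:Z * (99 * v%:Z) <= k%:Z * (100 * f%:Z) by rewrite ler_wpM2l //; lia.
  have : (2 * l%:Z) * v%:Z <= k%:Z * v%:Z by rewrite ler_wpM2r //; lia.
  by rewrite /u; lia.
have u_le' : u ^+ 2 <= k%:Z * v%:Z ^+ 2.
  apply: (le_trans u_le); rewrite [leRHS](_ : _ = v%:Z * k%:Z * v%:Z); last by ring.
  apply: ler_pM; rewrite ?mulr_ge0 ?ler_wpM2l //; lia.
(* Together with [u_le'] this yields 2401 k <= 10000, which fails for k >= 5. *)
have : (49 * (k%:Z * v%:Z)) ^+ 2 <= (100 * u) ^+ 2.
  by rewrite ler_pXn2r // nnegrE; lia.
have kv2 : 5 * (k%:Z * v%:Z ^+ 2) <= k%:Z * (k%:Z * v%:Z ^+ 2).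
  by rewrite ler_wpM2r ?mulr_ge0 ?sqr_ge0 //; lia.
have kv0 : 0 < k%:Z * v%:Z ^+ 2 by rewrite mulr_gt0 ?exprn_gt0 //; lia.
rewrite !exprMn; lia.
Qed.

(** The dual design has the same parameters, so the previous bound applies to the larger of [f] and
    [f'], and thereby bounds their sum. *)
Lemma symmetric_design_fixed_total e P Q v k l (s : {perm T}) :
  symmetric_design e P Q v k l -> (5 <= k)%N -> (2 * l <= k)%N ->
  (forall x y, e (s x) (s y) = e x y) ->
  {in P, forall x, s x \in P} -> {in Q, forall x, s x \in Q} ->
  let f := #|[set x in P | s x == x]| in
  let f' := #|[set x in Q | s x == x]| in
  (f + f' < v + v)%N -> (100 * (f + f') <= 99 * (v + v))%N.
Proof.
move=> D k5 lk se sP sQ f f' ltff.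
have [lef|ltf] := leqP f' f.
  have := symmetric_design_fixed_points D k5 lk se sQ lef; rewrite -/f; lia.
have := symmetric_design_fixed_points (symmetric_design_dual D) k5 lk
  (fun x y => se y x) sP (ltnW ltf).
rewrite -/f'; lia.
Qed.

(** From l(v - 1) = k(k - 1) and v >= 2k one gets l <= k(k - 1)/(2k - 1) < k/2. *)
Lemma symmetric_design_small_lambda e P Q v k l :
  symmetric_design e P Q v k l -> (0 < k)%N -> (2 * k <= v)%N ->
  (2 * l <= k)%N.
Proof.
move=> D k0 kv; have cnt : (k * k + l = k + l * v)%N.
  by apply: (symmetric_design_count D); lia.
rewrite leqNgt; apply/negP => lt.
have : (l * (2 * k) <= l * v)%N by rewrite leq_mul2l kv orbT.
nia.
Qed.

End SymmetricDesign.

(** * Distances and automorphisms in a connected bipartite graph *)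

Section BipartiteGraph.

Variables (X : sgraph) (A : {set X}).
Hypothesis conn : connected X.
Hypothesis bipA : forall x y : X, edge x y -> (x \in A) != (y \in A).
Implicit Types x y : X.

Lemma walk0 x y : walk 0 x y = (x == y).
Proof.
apply/existsP/idP => [[p]|xy]; first by rewrite tuple0.
by exists [tuple].
Qed.

Lemma walk1 x y : walk 1 x y = edge x y.
Proof.
apply/existsP/idP => [[p]|xy].
  by case/tupleP: p => z p; rewrite tuple0 /= andbT => /andP[xz /eqP <-].
by exists [tuple y]; rewrite /= xy eqxx.
Qed.

Lemma walk_parity m x y : walk m x y -> odd m = ((x \in A) != (y \in A)).
Proof.
case/existsP=> p /andP[ep /eqP <-]; rewrite -[in LHS](size_tuple p).
elim: (tval p) x ep => [|z q IHq] x /=; first by rewrite eqxx.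
case/andP=> /bipA xz /IHq ->.
by case: (x \in A) (z \in A) (last z q \in A) xz => [] [] [].
Qed.

Lemma dist_parity x y : odd (dist x y) = ((x \in A) != (y \in A)).
Proof. exact: (walk_parity (dist_walk (conn x y))). Qed.

Lemma dist_eq0 x y : (dist x y == 0)%N = (x == y).
Proof.
apply/eqP/eqP => [d0|->].
  by apply/eqP; rewrite -walk0 -d0; exact: (dist_walk (conn x y)).
by apply/eqP; rewrite -leqn0; apply: dist_min; rewrite walk0.
Qed.

Lemma dist_eq1 x y : (dist x y == 1)%N = edge x y.
Proof.
apply/eqP/idP => [d1|xy].
  by rewrite -walk1 -d1; exact: (dist_walk (conn x y)).
have := @dist_min X 1 x y; rewrite walk1 xy => /(_ isT).
have : odd (dist x y) by rewrite dist_parity bipA.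
by case: (dist x y) => [|[]].
Qed.

Lemma dist_le_diameter x y : (dist x y <= diameter X)%N.
Proof.
apply: leq_trans (leq_bigmax x) => /=.
exact: (leq_bigmax (F := fun y => dist x y)).
Qed.

(** Whether [s] switches the side of a vertex is constant along edges, hence everywhere by
    connectedness. *)
Lemma automorphism_side (s : {perm X}) x y :
  s \in automorphisms X ->
  ((s x \in A) (+) (x \in A)) = ((s y \in A) (+) (y \in A)).
Proof.
rewrite inE => /forallP auts; have /connectP[p ep ->] := conn x y.
elim: p x ep => //= z p IHp x /andP[xz /IHp <-].
have := forallP (auts x) z => /eqP; rewrite xz => /bipA; have := bipA xz.
by case: (x \in A) (z \in A) (s x \in A) (s z \in A) => [] [] [] [].
Qed.

Lemma neighbours_other_side x y : edge x y -> (y \in A) = (x \notin A).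
Proof. by move/bipA; case: (x \in A) (y \in A) => [] []. Qed.

End BipartiteGraph.

(** Distinct vertices on one side are at even distance at most 3, hence at distance 2, so [l] is the
    intersection number c_2. Counting edges from both sides shows that the sides have equal size. *)
Lemma symmetric_design_of_graph (X : sgraph) (A : {set X}) (k : nat) :
  (0 < k)%N -> regular X k -> distance_regular X -> diameter X = 3%N ->
  (forall x y : X, edge x y -> (x \in A) != (y \in A)) ->
  exists v l, (k < v)%N /\ symmetric_design (@edge X) A (~: A) v k l.
Proof.
move=> k0 hreg [conn dr] diam bip.
have side x y := @neighbours_other_side X A bip x y.
have rA p : p \in A -> #|[set q in ~: A | edge p q]| = k.
  move=> Ap; rewrite -(hreg p); apply: eq_card => q; rewrite !inE.
  by case: (boolP (edge p q)) => [/side ->|]; rewrite ?Ap ?andbF.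
have rB q : q \in ~: A -> #|[set p in A | edge p q]| = k.
  rewrite inE => Aq; rewrite -(hreg q); apply: eq_card => p.
  rewrite !inE [edge p q]edge_sym.
  by case: (boolP (edge q p)) => [/side ->|]; rewrite ?Aq ?andbF.
have cAB : #|A| = #|~: A|.
  apply/eqP; rewrite -(eqn_pmul2r k0) -!sum_nat_const; apply/eqP.
  by rewrite -(eq_bigr _ rA) -[RHS](eq_bigr _ rB) sum_card_exchange.
have [a2 [b2 [l drl]]] : exists a b c : nat, forall x y : X, dist x y = 2 ->
    [/\ #|[set z in neighbours y | dist x z == 2]| = a,
        #|[set z in neighbours y | dist x z == 3]| = b &
        #|[set z in neighbours y | (dist x z).+1 == 2]| = c].
  by apply: dr; rewrite diam.
have common x y : (x \in A) = (y \in A) -> x != y ->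
    #|[set z | edge x z && edge y z]| = l.
  move=> Axy nxy; have d2 : dist x y = 2.
    have := dist_le_diameter x y; have := dist_parity conn bip x y.
    move: nxy; rewrite -(dist_eq0 conn) Axy eqxx diam.
    by case: (dist x y) => [|[|[|[]]]].
  have [_ _ <-] := drl _ _ d2; apply: eq_card => z.
  by rewrite !inE eqSS (dist_eq1 conn bip) andbC.
have pA p p' : p \in A -> p' \in A -> p != p' ->
    #|[set q in ~: A | edge p q && edge p' q]| = l.
  move=> Ap Ap' ne; rewrite -(common p p') ?Ap ?Ap' //.
  apply: eq_card => q; rewrite !inE.
  by case: (boolP (edge p q)) => [/side ->|]; rewrite ?Ap ?andbF.
have pB q q' : q \in ~: A -> q' \in ~: A -> q != q' ->
    #|[set p in A | edge p q && edge p q']| = l.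
  rewrite !inE => Aq Aq' ne.
  rewrite -(common q q') ?(negbTE Aq) ?(negbTE Aq') //.
  apply: eq_card => p; rewrite !inE ![edge p _]edge_sym.
  by case: (boolP (edge q p)) => [/side ->|]; rewrite ?Aq ?andbF.
exists #|A|, l; split; last by split.
(* Vertices at distance 3 form a non-incident point and block; that block misses a point, whence
   [k < v]. *)
have /existsP[x /existsP[y d3]] : [exists x : X, exists y : X, 2 < dist x y]%N.
  apply: contraT => /existsPn no; suff : (diameter X <= 2)%N by rewrite diam.
  apply/bigmax_leqP => x _; apply/bigmax_leqP => y _.
  by have /existsPn/(_ y) := no x; rewrite -leqNgt.
have {}d3 : dist x y = 3.
  by have := dist_le_diameter x y; lia.
have := dist_parity conn bip x y; rewrite d3 => /esym Axy.
have nxy : ~~ edge x y by rewrite -(dist_eq1 conn bip) d3.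
have [p [q [Ap Aq npq]]] : exists p q, [/\ p \in A, q \in ~: A & ~~ edge p q].
  case: (boolP (x \in A)) Axy => Ax Ay.
    by exists x, y; rewrite inE; case: (y \in A) Ay.
  by exists y, x; rewrite inE edge_sym; case: (y \in A) Ay.
rewrite -(rB q Aq); apply: proper_card; apply/properP; split.
  by apply/subsetP => z; rewrite inE => /andP[].
by exists p; rewrite // inE negb_and npq orbT.
Qed.

(** The incidence [e] is kept apart from [edge] so that the complementary design is covered too. *)
Lemma automorphism_degree (X : sgraph) (A : {set X}) (e : rel X) v k l
    (s : {perm X}) :
  connected X -> (forall x y : X, edge x y -> (x \in A) != (y \in A)) ->
  symmetric_design e A (~: A) v k l -> (5 <= k)%N -> (2 * l <= k)%N ->
  (forall x y, e (s x) (s y) = e x y) ->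
  s \in automorphisms X -> s != 1%g -> (#|X| <= 100 * perm_degree s)%N.
Proof.
move=> conn bip D k5 lk se auts s1.
have deg : (perm_degree s + #|[set x in A | s x == x]| +
            #|[set x in ~: A | s x == x]| = #|X|)%N.
  rewrite -addnA -(cardsC [set x | s x == x]) addnC; congr (_ + _)%N.
    rewrite -cardsUI [X in (_ + #|pred_of_set X|)%N](_ : _ = set0).
      rewrite cards0 addn0; apply: eq_card => x.
      by rewrite !inE -andb_orl orbN.
    by apply/setP => x; rewrite !inE; case: (x \in A); rewrite ?andbF.
  by apply: eq_card => x; rewrite !inE.
have [[cA cB] _ _ _ _] := D.
have cX : #|X| = (v + v)%N by rewrite -{1}cA -cB cardsC.
have deg0 : (0 < perm_degree s)%N.
  rewrite card_gt0; apply: contraNneq s1 => s0; apply/eqP/permP => x.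
  rewrite perm1; apply/eqP/negPn.
  by have := in_set0 x; rewrite -s0 inE => ->.
have side x y := automorphism_side conn bip x y auts.
(* Without fixed vertices the degree is [#|X|]; a fixed vertex forces [s] to preserve both sides. *)
case: (pickP (fun x => s x == x)) => [x0 /eqP sx0|nofix]; last first.
  have -> : perm_degree s = #|X|; last by lia.
  by rewrite -cardsT; apply: eq_card => x; rewrite !inE nofix.
have sA x : (s x \in A) = (x \in A).
  by have := side x x0; rewrite sx0 addbb; case: (s x \in A); case: (x \in A).
have sP : {in A, forall x, s x \in A} by move=> x; rewrite sA.
have sQ : {in ~: A, forall x, s x \in ~: A} by move=> x; rewrite !inE sA.
have fixed_lt : (#|[set x in A | s x == x]| + #|[set x in ~: A | s x == x]| <
                 v + v)%N by lia.
have := symmetric_design_fixed_total D k5 lk se sP sQ fixed_lt; lia.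
Qed.


(** The complementary design has block size 1, so the non-adjacent pairs across the two sides form
    the deleted perfect matching. *)
Lemma cocktail_party_of_design (X : sgraph) (A : {set X}) v k l :
  (forall x y : X, edge x y -> (x \in A) != (y \in A)) ->
  symmetric_design (@edge X) A (~: A) v k l -> v = k.+1 ->
  cocktail_party X.
Proof.
move=> bip D vk; have [[cA cB] rA rB _ _] := symmetric_design_compl D.
have kv : (v - k = 1)%N by lia.
rewrite kv in rA rB.
pose M := [set [set p; q] | p in A, q in ~: A & ~~ edge p q].
have ne : forall p q p' q' : X, p \in A -> q \notin A -> p' \in A ->
    q' \notin A -> [set p; q] = [set p'; q'] -> p = p' /\ q = q'.
  move=> p q p' q' Ap Aq Ap' Aq' /setP E; split; apply/eqP.
    have := E p; rewrite !inE eqxx /= => /esym /orP[//|/eqP pq].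
    by rewrite -pq Ap in Aq'.
  have := E q; rewrite !inE eqxx orbT => /esym /orP[/eqP pq|//].
  by rewrite pq Ap' in Aq.
have inM p q : p \in A -> q \notin A -> ([set p; q] \in M) = ~~ edge p q.
  move=> Ap Aq; apply/imset2P/idP => [[p' q' Ap']|npq].
    by rewrite !inE => /andP[Aq' npq] /ne[] // -> ->.
  by exists p q; rewrite // !inE Aq.
have mate x : exists2 B, B \in M & x \in B.
  have [Ax|Ax] := boolP (x \in A).
    have /cards1P[q /setP /(_ q)] := introT eqP (rA x Ax).
    rewrite !inE eqxx => /andP[Aq nxq].
    by exists [set x; q]; rewrite ?inM // !inE eqxx.
  have /cards1P[p /setP /(_ p)] : #|[set p in A | ~~ edge p x]| == 1%N.
    by rewrite rB // inE.
  rewrite !inE eqxx => /andP[Ap npx].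
  by exists [set p; x]; rewrite ?inM // !inE eqxx orbT.
have uniqA p q q' : p \in A -> q \notin A -> q' \notin A ->
    ~~ edge p q -> ~~ edge p q' -> q = q'.
  move=> Ap Aq Aq' nq nq'.
  have /cards1P[z /setP E] := introT eqP (rA p Ap).
  by have := E q; have := E q'; rewrite !inE Aq Aq' nq nq' => /esym/eqP-> /esym/eqP->.
have uniqB p p' q : p \in A -> p' \in A -> q \notin A ->
    ~~ edge p q -> ~~ edge p' q -> p = p'.
  move=> Ap Ap' Aq np np'.
  have /cards1P[z /setP E] : #|[set p in A | ~~ edge p q]| == 1%N.
    by rewrite rB // inE.
  by have := E p; have := E p'; rewrite !inE Ap Ap' np np' => /esym/eqP-> /esym/eqP->.
have MP B : B \in M -> exists p q, [/\ p \in A, q \notin A, ~~ edge p q & B = [set p; q]].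
  by case/imset2P=> p q Ap; rewrite !inE => /andP[Aq npq] ->; exists p, q.
exists A, M; split; first by rewrite cA cB.
  split; last by move=> B /MP[p [q [Ap Aq _ ->]]]; exists p, q.
  apply/and3P; split.
  - rewrite eqEsubset subsetT; apply/subsetP => x _.
    by have [B MB xB] := mate x; apply/bigcupP; exists B.
  - apply/trivIsetP => B B' /MP[p [q [Ap Aq npq ->]]] /MP[p' [q' [Ap' Aq' npq' ->]]].
    (* Two pairs sharing a vertex share it on the same side, and uniqueness of the mate makes them
       equal. *)
    apply: contraR => /pred0Pn[x] /=; rewrite !inE.
    case/andP=> /orP[]/eqP-> /orP[]/eqP E; subst.
    + by rewrite (uniqA p' q q').
    + by rewrite Ap in Aq'.
    + by rewrite Ap' in Aq.
    + by rewrite (uniqB p p' q').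
  - apply/negP => /MP[p [q [_ _ _ /setP/(_ p)]]].
    by rewrite !inE eqxx.
move=> x y; have [xy|] := boolP (edge x y).
  rewrite bip //=; have := bip _ _ xy.
  have [Ax|Ax] := boolP (x \in A); have [Ay|Ay] := boolP (y \in A) => // _.
    by rewrite inM ?xy.
  by rewrite setUC inM // edge_sym xy.
move=> nxy; apply/esym/negbTE; rewrite negb_and !negbK.
have [Ax|Ax] := boolP (x \in A); have [Ay|Ay] := boolP (y \in A) => //=.
  by rewrite inM.
by rewrite setUC inM // edge_sym.
Qed.

Lemma cocktail_party_or_large_degree (X : sgraph) (k : nat) :
  (400 <= k)%N -> regular X k -> bipartite X -> distance_regular X ->
  diameter X = 3%N ->
  cocktail_party X \/
  forall s, s \in automorphisms X -> s != 1%g ->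
    (#|X| <= 100 * perm_degree s)%N.
Proof.
move=> hk hreg [A bip] hdr hdiam; have [conn _] := hdr.
have k0 : (0 < k)%N by lia.
have [v [l [kv D]]] := symmetric_design_of_graph k0 hreg hdr hdiam bip.
have aut s : s \in automorphisms X -> forall x y, edge (s x) (s y) = edge x y.
  by rewrite inE => /forallP auts x y; apply/eqP/(forallP (auts x)).
have [small|big] := leqP (2 * k) v.
  right=> s auts; apply: (automorphism_degree conn bip D _ _ _ auts) => //.
  - by lia.
  - exact: (symmetric_design_small_lambda D).
  - exact: aut.
have [vk|vk] := eqVneq v k.+1; first by left; apply: (cocktail_party_of_design bip D vk).
right=> s auts; have D' := symmetric_design_compl D.
have cnt := symmetric_design_count D' (leq_ltn_trans (leq0n _) kv).
set l' := (v + l - _)%N in D' cnt.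
(* [k' (k' - 1) = l' (v - 1) >= 400] for the complementary block size [k']. *)
have l'0 : (0 < l')%N.
  (* Otherwise k' * k' = k', against k' >= 2, which holds because v > k and v differs from k + 1. *)
  case: (posnP l') => // l'0; move: cnt; rewrite l'0 mul0n !addn0 => cnt.
  have : (2 <= v - k)%N by lia.
  by nia.
have k'5 : (5 <= v - k)%N.
  rewrite leqNgt; apply/negP => lt.
  have : (l' * 400 <= l' * v)%N by rewrite leq_mul2l; lia.
  nia.
apply: (automorphism_degree conn bip D' k'5 _ _ auts) => //.
  (* In this case v < 2k, that is, 2(v - k) < v. *)
  by apply: (symmetric_design_small_lambda D'); lia.
by move=> x y; rewrite aut.
Qed.

Theorem theorem3p15 (X : sgraph) (k : nat) (hk : (400 <= k)%N)
    (hreg : regular X k) (hbip : bipartite X) (hdr : distance_regular X)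
    (hdiam : diameter X = 3%N) :
  cocktail_party X \/ #|X|%:R / 100%:R <= (motion X)%:R :> rat.
Proof.
have [|deg] := cocktail_party_or_large_degree hk hreg hbip hdr hdiam; first by left.
right; rewrite ler_pdivrMr ?ltr0n // -natrM ler_nat mulnC.
rewrite /motion /minimal_degree; apply: (big_ind (fun m => #|X| <= 100 * m)%N).
(* The default value [#|X|] of the minimum satisfies the bound as well. *)
- by rewrite leq_pmull.
- by move=> m n lem len; rewrite /minn; case: ifP.
- by move=> s /andP[auts s1]; apply: deg.
Qed.
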